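(* Fix $K\ge2$ and assume $\frac nK\ge2$. Let $\Theta=\Theta(n,K,a,b)$ be the homogeneous balanced SBM parameter class with $K$ communities, within-community edge probability $a/n$, across-community edge probability $b/n$, and balanced labelings in $\Sigma$. For each $\theta\in\Theta$, let $\sigma_\theta\in\Sigma$ be a representative ground-truth labeling, and let $\mathbb P_\theta$ and $\mathbb E_\theta$ denote the corresponding SBM probability and expectation (including the internal randomness of the mechanism). Then $$\inf_{\mathcal M:\,\rho\text{-node-zCDP}}\ \sup_{\theta\in\Theta}\mathbb P_\theta\bigl(r(\sigma_\theta,\mathcal M(A))>0\bigr)\ge\frac14e^{-4\rho}$$ and $$\inf_{\mathcal M:\,\rho\text{-node-zCDP}}\ \sup_{\theta\in\Theta}\mathbb E_\theta\bigl[r(\sigma_\theta,\mathcal M(A))\bigr]\ge\frac1{4n}e^{-4\rho},$$ where the infima are over all $\rho$-node-zCDP randomized mechanisms $\mathcal M:\mathcal G_n\to[K]^n$.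
   Context: $n,K$ are integers with $K\mid n$. $\mathcal G_n$ is the set of undirected graphs on $[n]=\{1,\dots,n\}$, identified with symmetric zero-diagonal adjacency matrices $A\in\{0,1\}^{n\times n}$. $\Sigma=\{\sigma:[n]\to[K]:|\sigma^{-1}(k)|=n/K\ \forall k\in[K]\}$. The SBM with ground truth $\sigma\in\Sigma$ draws the upper-triangular entries of $A$ independently with $\mathbb P(A_{ij}=1)=a/n$ if $\sigma(i)=\sigma(j)$ and $b/n$ otherwise; the class $\Theta$ consists of the SBMs obtained as $\sigma$ ranges over $\Sigma$. For $\sigma,\tau\in[K]^n$: $h(\sigma,\tau)=|\{i:\sigma_i\ne\tau_i\}|$ and $r(\sigma,\tau)=\frac1n\min_{\pi\in\mathfrak S_K}h(\pi\circ\sigma,\tau)$, with $\mathfrak S_K$ the permutations of $[K]$. Two graphs are node-adjacent, $A\sim_vA'$, if they differ only on edges incident to a single vertex. For $\alpha>1$ and distributions $P,Q$ on a finite set, $D_\alpha(P\|Q)=\frac1{\alpha-1}\log\big(\sum_yP(y)^\alpha Q(y)^{1-\alpha}\big)$. A randomized mechanism $\mathcal M:\mathcal G_n\to[K]^n$ is $\rho$-node-zCDP if $D_\alpha(\mathcal L(\mathcal M(A))\,\|\,\mathcal L(\mathcal M(A')))\le\alpha\rho$ for all $A\sim_vA'$ and all $\alpha>1$, where $\mathcal L(\cdot)$ denotes the law over the mechanism's internal randomness. *)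

(* Defs.v *)
From mathcomp Require Export all_boot all_order all_algebra all_fingroup.
From mathcomp Require Export all_classical all_reals all_analysis.

Set Implicit Arguments.
Unset Strict Implicit.
Unset Printing Implicit Defensive.

Import Order.TTheory GRing.Theory Num.Theory.

Local Open Scope classical_set_scope.
Local Open Scope ring_scope.

Definition is_adjacency (n : nat) (A : 'M[bool]_n) : bool :=
  [forall i, ~~ A i i] && [forall i, [forall j, A i j == A j i]].

Definition graph (n : nat) : finType := {A : 'M[bool]_n | is_adjacency A}.

Definition edge (n : nat) (A : graph n) (i j : 'I_n) : bool := sval A i j.

(* A and A' may also coincide. *)
Definition node_adjacent (n : nat) (A A' : graph n) : Prop :=
  exists v : 'I_n, forall i j : 'I_n,
    i != v -> j != v -> edge A i j = edge A' i j.

Definition labeling (n K : nat) : finType := {ffun 'I_n -> 'I_K}.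

Definition Sigma (n K : nat) : set (labeling n K) :=
  [set s | forall k : 'I_K, #|[pred i | s i == k]| = (n %/ K)%N].

Definition relabel (n K : nat) (p : {perm 'I_K}) (s : labeling n K) :
  labeling n K := [ffun i => p (s i)].

Definition hamming (n K : nat) (s t : labeling n K) : nat :=
  #|[pred i | s i != t i]|.

(* The default value n of the iterated minimum bounds every Hamming distance,
   hence this is the minimum over the (nonempty) set of permutations. *)
Definition mismatch (R : realType) (n K : nat) (s t : labeling n K) : R :=
  (\big[minn/n]_(p : {perm 'I_K}) hamming (relabel p s) t)%:R / n%:R.

Definition edge_prob (R : realType) (n K : nat) (a b : R) (s : labeling n K)
    (i j : 'I_n) : R :=
  if s i == s j then a / n%:R else b / n%:R.

Definition sbm_pmf (R : realType) (n K : nat) (a b : R) (s : labeling n K)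
    (A : graph n) : R :=
  \prod_(i < n) \prod_(j < n | (i < j)%N)
    (if edge A i j then edge_prob a b s i j else 1 - edge_prob a b s i j).

Record fdist (R : realType) (T : finType) := FDist {
  fdist_pmf :> T -> R;
  fdist_ge0 : forall x, 0 <= fdist_pmf x;
  fdist_sum1 : \sum_x fdist_pmf x = 1 }.

(* A randomized mechanism is given by the law of its output on each input. *)
Definition mechanism (R : realType) (n K : nat) : Type :=
  graph n -> fdist R (labeling n K).

(* p^alpha q^(1 - alpha) for alpha > 1, with the usual conventions at q = 0:
   +oo if p > 0, and 0 if p = 0.  The case split is needed because powR
   evaluates 0 to a negative power as 0. *)
Definition renyi_term (R : realType) (alpha p q : R) : \bar R :=
  if q == 0 then (if p == 0 then 0%E else +oo%E)
  else (p `^ alpha * q `^ (1 - alpha))%:E.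

Definition renyi_div (R : realType) (T : finType) (alpha : R)
    (P Q : fdist R T) : \bar R :=
  (((alpha - 1)^-1)%:E * lne (\sum_(y : T) renyi_term alpha (P y) (Q y)))%E.

Definition node_zCDP (R : realType) (n K : nat) (rho : R) :
    set (mechanism R n K) :=
  [set M | forall A A' : graph n, node_adjacent A A' ->
     forall alpha : R, 1 < alpha ->
       (renyi_div alpha (M A) (M A') <= (alpha * rho)%:E)%E].

(* Joint law of the graph A and of the output M(A), for ground truth s. *)
Definition joint_pmf (R : realType) (n K : nat) (a b : R) (s : labeling n K)
    (M : mechanism R n K) (A : graph n) (t : labeling n K) : R :=
  sbm_pmf a b s A * M A t.

Definition sbm_Pr (R : realType) (n K : nat) (a b : R) (s : labeling n K)
    (M : mechanism R n K) (E : pred (labeling n K)) : R :=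
  \sum_(A : graph n) \sum_(t : labeling n K | E t) joint_pmf a b s M A t.

Definition sbm_Ex (R : realType) (n K : nat) (a b : R) (s : labeling n K)
    (M : mechanism R n K) (X : labeling n K -> R) : R :=
  \sum_(A : graph n) \sum_(t : labeling n K) joint_pmf a b s M A t * X t.

(* A labeling is determined by the communities only up to a permutation of the
   labels: [rep] chooses, for the model with ground truth s, some balanced
   labeling with the same communities ([rep = id] is allowed). *)
Definition representatives (n K : nat) (rep : labeling n K -> labeling n K) :
    Prop :=
  forall s, Sigma s -> Sigma (rep s) /\ exists p, rep s = relabel p s.

(* Main.v *)
(** Only the order alpha = 2 of zCDP is needed.  Let [theta'] be [theta] with the
    labels of two vertices u, v of different communities exchanged; no labeling
    is a relabeling of both.  Exchanging the vertices u, v of A ~ SBM(theta)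
    couples it with A' ~ SBM(theta') in such a way that some graph B is
    node-adjacent to both A and A'.  The chi-square bounds
    [M(B)(E)^2 <= e^(2 rho) M(A)(E)] and
    [M(B)(~E)^2 <= e^(2 rho) M(A')(~E)] give, pointwise in A,
    [M(A)(E) + M(A')(~E) >= e^(-2 rho) / 2 >= e^(-4 rho) / 2]; averaging over A
    with E the event that [theta] is not recovered, one of the two error
    probabilities is at least [e^(-4 rho) / 4]. *)
From mathcomp Require Import ring lra zify.
Require Import Defs.

Set Implicit Arguments.
Unset Strict Implicit.
Unset Printing Implicit Defensive.

Import Order.TTheory GRing.Theory Num.Theory.

Local Open Scope classical_set_scope.
Local Open Scope ring_scope.

(** * Testing consequences of zCDP at order 2 *)

Lemma fdist_mass (R : realType) (T : finType) (P : fdist R T) (E : pred T) :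
  \sum_(y | ~~ E y) P y = 1 - \sum_(y | E y) P y.
Proof. by rewrite -(fdist_sum1 P) [X in X - _](bigID E) /= addrAC subrr add0r. Qed.

(** The gap is the square [(p - c * q) ^+ 2 / q]. A bound linear in [p] and [q] can be summed over
    an event directly, in place of Cauchy-Schwarz, and it survives the convention at [q = 0]. *)
Lemma renyi_term2_ge (R : realType) (c p q : R) : 0 <= p -> 0 <= q ->
  ((2 * c * p - c ^+ 2 * q)%:E <= renyi_term 2 p q)%E.
Proof.
move=> p0 q0; rewrite /renyi_term; case: eqVneq => [->|qn0].
  by case: eqVneq => [->|_]; rewrite ?leey// lee_fin; lra.
have -> : 1 - 2 = -1 :> R by lra.
rewrite powR_mulrn// powR_inv1// lee_fin -subr_ge0.
have -> : p ^+ 2 / q - (2 * c * p - c ^+ 2 * q) = (p - c * q) ^+ 2 / q by field.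
by rewrite divr_ge0 ?sqr_ge0.
Qed.

Lemma renyi_term_ge0 (R : realType) (alpha p q : R) :
  (0 <= renyi_term alpha p q)%E.
Proof.
rewrite /renyi_term; case: ifP => _; first by case: ifP.
by rewrite lee_fin mulr_ge0 ?powR_ge0.
Qed.

(* Variational form of [P(E)^2 <= e^(2 rho) Q(E)]. *)
Lemma renyi_div2_event (R : realType) (T : finType) (rho : R)
    (P Q : fdist R T) :
  (renyi_div 2 P Q <= (2 * rho)%:E)%E ->
  forall (E : pred T) (c : R),
    2 * c * (\sum_(y | E y) P y) - c ^+ 2 * (\sum_(y | E y) Q y)
      <= expR (2 * rho).
Proof.
rewrite /renyi_div; set S := (\sum_(y : T) _)%E => hdiv E c.
have S0 : (0 <= S)%E by apply: sume_ge0 => y _; exact: renyi_term_ge0.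
have {hdiv} SX : (S <= (expR (2 * rho))%:E)%E.
  move: hdiv; have -> : (2 - 1 : R)^-1 = 1 by rewrite -[2]/(1 + 1) addrK invr1.
  rewrite mul1e -lee_expeR lneK ?in_itv/= ?S0 ?leey//.
rewrite -lee_fin; apply: le_trans SX.
(* Only the terms in [E] receive the linear bound; those outside are nonnegative and dropped. *)
rewrite !mulr_sumr -sumrB -sumEFin /S [leRHS](bigID E)/=.
rewrite -[leLHS]adde0; apply: leeD.
  by apply: lee_sum => y _; apply: renyi_term2_ge; apply: fdist_ge0.
by apply: sume_ge0 => y _; exact: renyi_term_ge0.
Qed.

(** Comparing [A] with itself on the full event at [c = 1] gives [1 <= expR (2 * rho)]. *)
Lemma zCDP_rho_ge0 (R : realType) (n K : nat) (rho : R) (M : mechanism R n K)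
    (A : graph n) (v : 'I_n) : node_zCDP rho M -> 0 <= rho.
Proof.
move=> hM; have hAA : node_adjacent A A by exists v.
have := renyi_div2_event (hM _ _ hAA 2 (ltr1n _ _)) (fun=> true) 1.
rewrite !fdist_sum1 => h.
have : expR 0 <= expR (2 * rho) :> R by rewrite expR0; lra.
by rewrite ler_expR; lra.
Qed.

(* Both [M A] and [M A'] are compared with [M B]: with c = 2 e^(2 rho) the two
   variational inequalities, for E and its complement, add up to the claim. *)
Lemma two_step_testing (R : realType) (n K : nat) (rho : R)
    (M : mechanism R n K) (A B A' : graph n) (E : pred (labeling n K)) :
  node_zCDP rho M -> node_adjacent B A -> node_adjacent B A' ->
  2^-1 * expR (- (4 * rho)) <=
    \sum_(t | E t) M A t + \sum_(t | ~~ E t) M A' t.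
Proof.
move=> hM hA hA'; have rho0 : 0 <= rho.
  by case: hA => v _; exact: (zCDP_rho_ge0 A v hM).
set X := expR (2 * rho); have X0 : 0 < X by exact: expR_gt0.
have h1 := renyi_div2_event (hM _ _ hA 2 (ltr1n _ _)) E (2 * X).
have h2 := renyi_div2_event (hM _ _ hA' 2 (ltr1n _ _)) (predC E) (2 * X).
rewrite /= fdist_mass in h2.
set p := \sum_(t | E t) M A t in h1 *.
set q := \sum_(t | ~~ E t) M A' t in h2 *.
set s := \sum_(t | E t) M B t in h1 h2.
apply: (@le_trans _ _ (2^-1 * X^-1)).
  by rewrite ler_pM2l ?invr_gt0// /X -expRN ler_expR; lra.
rewrite -/X in h1 h2.
have h : 2 * X <= 4 * X * X * (p + q).
  by lra.
rewrite -invfM -[leLHS]mul1r ler_pdivrMr ?mulr_gt0// -(ler_pM2l X0); lra.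
Qed.

(** * Graphs and labelings under vertex permutations *)

Lemma edgexx (n : nat) (A : graph n) (i : 'I_n) : edge A i i = false.
Proof. by apply/negbTE; case: A => A H; have /andP[/forallP/(_ i)] := H. Qed.

Lemma edge_sym (n : nat) (A : graph n) (i j : 'I_n) : edge A i j = edge A j i.
Proof.
by apply/eqP; case: A => A H; have /andP[_ /forallP/(_ i)/forallP/(_ j)] := H.
Qed.

Lemma graph_eqP (n : nat) (A B : graph n) :
  (forall i j, edge A i j = edge B i j) -> A = B.
Proof. by move=> h; apply: val_inj; apply/matrixP => i j; exact: h. Qed.

Section GraphOf.
Variables (n : nat) (e : 'I_n -> 'I_n -> bool).

(** Symmetrizing [e] and clearing the diagonal lets any boolean relation define a graph without side
    conditions. *)
Definition graph_mx : 'M[bool]_n :=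
  \matrix_(i, j) ((i != j) && (e i j || e j i)).

Lemma graph_mx_adjacency : is_adjacency graph_mx.
Proof.
apply/andP; split; first by apply/forallP => i; rewrite mxE eqxx.
by apply/forallP => i; apply/forallP => j; rewrite !mxE (eq_sym i j) orbC.
Qed.

Definition graph_of : graph n := exist _ graph_mx graph_mx_adjacency.

Lemma edge_graph_of i j : edge graph_of i j = (i != j) && (e i j || e j i).
Proof. by rewrite /edge /= mxE. Qed.

End GraphOf.

Definition graph_perm (n : nat) (p : 'S_n) (A : graph n) : graph n :=
  graph_of (fun i j => edge A (p i) (p j)).

Lemma edge_graph_perm (n : nat) (p : 'S_n) (A : graph n) i j :
  edge (graph_perm p A) i j = edge A (p i) (p j).
Proof.
rewrite edge_graph_of [edge A (p j) _]edge_sym orbb.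
by case: eqVneq => // ->; rewrite edgexx.
Qed.

Lemma graph_permK (n : nat) (p : 'S_n) :
  cancel (graph_perm p) (graph_perm p^-1).
Proof. by move=> A; apply: graph_eqP => i j; rewrite !edge_graph_perm !permKV. Qed.

Definition label_perm (n K : nat) (p : 'S_n) (s : labeling n K) :
  labeling n K := [ffun i => s (p i)].

Lemma Sigma_label_perm (n K : nat) (p : 'S_n) (s : labeling n K) :
  Sigma s -> Sigma (label_perm p s).
Proof.
move=> hs k; rewrite -[RHS](hs k) -!sum1_card [RHS](reindex_inj (@perm_inj _ p)).
by apply: eq_bigl => i; rewrite !inE ffunE.
Qed.

(** A permutation acts on unordered pairs: [h q] applies [q] to a pair and sorts the result,
    [h q^-1] undoes this, and the symmetric [F] does not see the sorting. *)
Lemma prod_pairs_perm (R : comPzRingType) (n : nat) (p : 'S_n)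
    (F : 'I_n -> 'I_n -> R) : (forall i j, F i j = F j i) ->
  \prod_(i < n) \prod_(j < n | (i < j)%N) F (p i) (p j) =
  \prod_(i < n) \prod_(j < n | (i < j)%N) F i j.
Proof.
move=> Fsym.
pose h (q : 'S_n) (x : 'I_n * 'I_n) :=
  if (q x.1 < q x.2)%N then (q x.1, q x.2) else (q x.2, q x.1).
have hlt q (x : 'I_n * 'I_n) : (x.1 < x.2)%N -> ((h q x).1 < (h q x).2)%N.
  rewrite /h => xlt; case: (ltnP (q x.1) (q x.2)) => //=.
  by rewrite leq_eqVlt => /predU1P[/val_inj x21|//]; rewrite (perm_inj x21) ltnn in xlt.
have hK q (x : 'I_n * 'I_n) : (x.1 < x.2)%N -> h q^-1%g (h q x) = x.
  case: x => i j /= ij; rewrite /h/=.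
  by case: (ltnP (q i)) => _ /=; rewrite !permK ?ij // ltnNge (ltnW ij).
rewrite !pair_big_dep/= [RHS](reindex_onto (h p) (h p^-1%g)); last first.
  by move=> x /(hK p^-1%g); rewrite invgK.
apply: eq_big => [x|x _].
  apply/idP/andP => [xlt|[xlt /eqP <-]]; first by rewrite hlt// hK.
  exact: hlt.
by rewrite /h; case: ifP => //= _; rewrite Fsym.
Qed.

(** * The SBM law: invariance, positivity, total mass *)

Section Sbm.
Variables (R : realType) (n K : nat) (a b : R).

Lemma edge_prob_sym (s : labeling n K) i j :
  edge_prob a b s i j = edge_prob a b s j i.
Proof. by rewrite /edge_prob (eq_sym (s i)). Qed.

Lemma sbm_pmf_perm (p : 'S_n) (s : labeling n K) (A : graph n) :
  sbm_pmf a b (label_perm p s) (graph_perm p A) = sbm_pmf a b s A.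
Proof.
rewrite /sbm_pmf -[RHS](prod_pairs_perm p) => [|i j]; last first.
  by rewrite edge_sym edge_prob_sym.
apply: eq_bigr => i _; apply: eq_bigr => j _.
by rewrite edge_graph_perm /edge_prob !ffunE.
Qed.

Lemma sbm_pmf_ge0 (s : labeling n K) (A : graph n) :
  0 <= a <= n%:R -> 0 <= b <= n%:R -> 0 <= sbm_pmf a b s A.
Proof.
move=> /andP[a0 an] /andP[b0 bn].
apply: prodr_ge0 => i _; apply: prodr_ge0 => j _.
have n0 : 0 < n%:R :> R by rewrite ltr0n (leq_ltn_trans _ (ltn_ord i)).
have /andP[e0 e1] : 0 <= edge_prob a b s i j <= 1.
  by rewrite /edge_prob; case: ifP => _; rewrite divr_ge0 ?ler_pdivrMr ?mul1r ?ler0n.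
by case: ifP => _ //; rewrite subr_ge0.
Qed.

(** Each pair [i < j] contributes a Bernoulli law of mass 1. Distributing the product of these
    masses gives a sum over boolean functions supported on such pairs, which [h] and [h'] identify
    with graphs. *)
Lemma sbm_pmf_sum1 (s : labeling n K) : \sum_(A : graph n) sbm_pmf a b s A = 1.
Proof.
pose P := fun x : 'I_n * 'I_n => (x.1 < x.2)%N.
pose F := fun (x : 'I_n * 'I_n) (c : bool) =>
  if c then edge_prob a b s x.1 x.2 else 1 - edge_prob a b s x.1 x.2.
have : \prod_(x | P x) \sum_(c : bool) F x c = 1.
  by apply: big1 => x _; rewrite big_bool /F /= addrC subrK.
rewrite (big_distr_big false P predT) => <-.
pose h (A : graph n) : {ffun 'I_n * 'I_n -> bool} :=
  [ffun x => P x && edge A x.1 x.2].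
pose h' (f : {ffun 'I_n * 'I_n -> bool}) := graph_of (fun i j => f (i, j)).
have hK A : h' (h A) = A.
  apply: graph_eqP => i j; rewrite edge_graph_of !ffunE /P /=.
  rewrite [edge A j i]edge_sym -(inj_eq val_inj).
  by case: ltngtP => //= [_|/val_inj ->]; rewrite ?orbF ?edgexx.
rewrite [RHS](reindex_onto h h') => [|f /pffun_onP[/fintype.subsetP fP _]].
  apply: eq_big => [A|A _].
    rewrite hK eqxx andbT; apply/esym/pffun_onP; split => //.
    by apply/fintype.subsetP => x; rewrite !inE ffunE unfold_in -/(P x); case: (P x).
  rewrite /sbm_pmf pair_big_dep /=; apply: eq_bigr => x Px.
  by rewrite /F ffunE; rewrite /P in Px *; rewrite Px.
have {}fP x : f x -> P x by move=> fx; have := fP x; rewrite !inE fx unfold_in; apply.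
apply/ffunP => -[i j]; rewrite ffunE edge_graph_of /P /=.
have := fP (i, j); have := fP (j, i); rewrite /P /= -(inj_eq val_inj) /=.
case: ltngtP => //= _; case: (f (i, j)); case: (f (j, i)) => //= hji hij;
  by first [have := hji isT | have := hij isT].
Qed.

End Sbm.

(** * The coupling by a vertex swap *)

Lemma middle_graph (n : nat) (u v : 'I_n) (A A' : graph n) :
  (forall i j, i != u -> i != v -> j != u -> j != v ->
     edge A i j = edge A' i j) ->
  exists B, node_adjacent B A /\ node_adjacent B A'.
Proof.
move=> hAA'.
(* [B] follows [A'] at [u] and [A] elsewhere, so it differs from [A] only at [u]; off [u] it can
   differ from [A'] only at [v]. *)
exists (graph_of (fun i j =>
  if (i == u) || (j == u) then edge A' i j else edge A i j)).
split; [exists u | exists v] => i j hi hj; rewrite edge_graph_of.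
  rewrite (negbTE hi) (negbTE hj) /= [edge A j i]edge_sym orbb.
  by case: eqVneq => // ->; rewrite edgexx.
rewrite (orbC (j == u)) [edge A j i]edge_sym [edge A' j i]edge_sym orbb.
case: eqVneq => [->|_]; first by rewrite edgexx.
by case: ifP => //= /norP[iu ju]; exact: hAA'.
Qed.

Lemma graph_tperm_near (n : nat) (u v : 'I_n) (A : graph n) :
  exists B, node_adjacent B A /\ node_adjacent B (graph_perm (tperm u v) A).
Proof.
apply: (@middle_graph n u v) => i j iu iv ju jv.
by rewrite edge_graph_perm !tpermD // eq_sym.
Qed.

Lemma sbm_PrE (R : realType) (n K : nat) (a b : R) (s : labeling n K)
    (M : mechanism R n K) (E : pred (labeling n K)) :
  sbm_Pr a b s M E = \sum_(A : graph n) sbm_pmf a b s A * \sum_(t | E t) M A t.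
Proof. by apply: eq_bigr => A _; rewrite mulr_sumr. Qed.

Lemma sbm_Pr_mono (R : realType) (n K : nat) (a b : R) (s : labeling n K)
    (M : mechanism R n K) (E F : pred (labeling n K)) :
  0 <= a <= n%:R -> 0 <= b <= n%:R -> (forall t, E t -> F t) ->
  sbm_Pr a b s M E <= sbm_Pr a b s M F.
Proof.
move=> ha hb EF; apply: ler_sum => A _.
rewrite [leRHS]big_mkcond [leLHS]big_mkcond; apply: ler_sum => t _.
have := EF t; case: (E t) => [->//|_].
by case: (F t) => //; rewrite mulr_ge0 ?sbm_pmf_ge0 ?fdist_ge0.
Qed.

(* Exchanging the labels of u and v is the same as exchanging the vertices u
   and v of the graph, and this moves the graph by two node changes. *)
Lemma sbm_swap_testing (R : realType) (n K : nat) (a b rho : R)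
    (s : labeling n K) (u v : 'I_n) (M : mechanism R n K)
    (E : pred (labeling n K)) :
  0 <= a <= n%:R -> 0 <= b <= n%:R -> node_zCDP rho M ->
  2^-1 * expR (- (4 * rho)) <=
    sbm_Pr a b s M E + sbm_Pr a b (label_perm (tperm u v) s) M (predC E).
Proof.
move=> ha hb hM; rewrite !sbm_PrE.
rewrite [X in _ + X](reindex_inj (can_inj (graph_permK (tperm u v)))) /=.
rewrite -big_split /=; set c := leLHS.
(* Writing the constant as its average over the SBM law reduces the claim to a bound for each
   graph. *)
rewrite -[c]mul1r -(sbm_pmf_sum1 a b s) mulr_suml.
apply: ler_sum => A _; rewrite sbm_pmf_perm -mulrDr.
apply: ler_wpM2l; first exact: sbm_pmf_ge0.
have [B [hA hA']] := graph_tperm_near u v A.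
exact: two_step_testing hM hA hA'.
Qed.

(** * Exact recovery and the mismatch *)

Lemma mismatch_le0 (R : realType) (n K : nat) (s t : labeling n K) :
  (0 < n)%N -> ~~ (0 < mismatch R s t) -> exists p, relabel p s = t.
Proof.
move=> n0; apply: contraNP => /forallNP h.
(* The default value [n] of the minimum is itself positive, so positivity of every Hamming distance
   passes to the minimum. *)
rewrite /mismatch divr_gt0 ?ltr0n//; apply: (big_ind (fun m => 0 < m)%N) => //.
  by move=> x y x0 y0; rewrite leq_min x0.
move=> p _; rewrite lt0n; apply/negP => /eqP /card0_eq h0; apply: (h p).
by apply/ffunP => i; have := h0 i; rewrite !inE => /negbFE/eqP.
Qed.

(** The numerator is a natural number, hence at least 1 once positive. For [n = 0] both sides
    vanish, as division by 0 gives 0. *)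
Lemma mismatch_ge (R : realType) (n K : nat) (s t : labeling n K) :
  (0 < mismatch R s t)%R%:R / n%:R <= mismatch R s t.
Proof.
rewrite /mismatch; set m := \big[minn/n]_(p : _) _.
have [/eqP->|n0] := boolP (n == 0%N); first by rewrite invr0 !mulr0.
have n0' : 0 < n%:R :> R by rewrite ltr0n lt0n.
by rewrite ler_pM2r ?invr_gt0// ler_nat pmulr_lgt0 ?invr_gt0// ltr0n; case: m.
Qed.

Lemma sbm_Ex_mismatch_ge (R : realType) (n K : nat) (a b : R)
    (s s' : labeling n K) (M : mechanism R n K) :
  0 <= a <= n%:R -> 0 <= b <= n%:R ->
  sbm_Pr a b s M (fun t => 0 < mismatch R s' t) / n%:R <=
    sbm_Ex a b s M (fun t => mismatch R s' t).
Proof.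
move=> ha hb; rewrite mulr_suml; apply: ler_sum => A _.
rewrite mulr_suml big_mkcond; apply: ler_sum => t _.
have J0 : 0 <= joint_pmf a b s M A t.
  by rewrite mulr_ge0 ?sbm_pmf_ge0 ?fdist_ge0.
apply: le_trans (ler_wpM2l J0 (mismatch_ge R s' t)).
by case: ifP => _; rewrite ?mul1r ?mul0r ?mulr0.
Qed.

(** * Balanced labelings and the pair to be tested *)

Lemma Sigma_nonempty (n K : nat) : (0 < K)%N -> (K %| n)%N ->
  exists s : labeling n K, Sigma s.
Proof.
(* Label by residue modulo [K]: the class of [k] is enumerated by [j * K + k] for [j < n %/ K]. *)
move=> K0 hdvd; exists [ffun i : 'I_n => Ordinal (ltn_pmod i K0)] => k.
have lt_n (j : 'I_(n %/ K)) : (j * K + k < n)%N.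
  by have := ltn_ord j; have := ltn_ord k; rewrite -{4}(divnK hdvd); nia.
pose f j := Ordinal (lt_n j).
have f_inj : injective f.
  by move=> i j /(congr1 val)/= h; apply: val_inj => /=; nia.
rewrite -[RHS]card_ord -(card_imset predT f_inj); apply: eq_card => i.
rewrite !inE ffunE -val_eqE /=; apply/eqP/imsetP => [ik|[j _ ->]]; last first.
  by rewrite /= modnMDl modn_small.
have lt_d : (i %/ K < n %/ K)%N by rewrite ltn_divLR // divnK.
by exists (Ordinal lt_d) => //; apply: val_inj; rewrite /= -ik -divn_eq.
Qed.

(** Take [u], [w] with label 0 and [v] with label 1. After the swap [u] has label 1 while [w] keeps
    0, so a relabeling would send 0 to both values. Communities of size at least 2 provide [w]. *)
Lemma Sigma_swap_pair (n K : nat) (s : labeling n K) :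
  (2 <= K)%N -> (2 <= n %/ K)%N -> Sigma s ->
  exists u v, forall p : {perm 'I_K}, label_perm (tperm u v) s <> relabel p s.
Proof.
move=> hK hnK hs.
have /card_gt1P[u [w [su sw uw]]] : (1 < #|[pred i | s i == Ordinal (ltnW hK)]|)%N.
  by rewrite hs.
have /card_gt0P[v sv] : (0 < #|[pred i | s i == Ordinal hK]|)%N.
  by rewrite hs ltnW.
move: su sw sv; rewrite !inE => /eqP su /eqP sw /eqP sv.
exists u, v => p hp.
have wv : v != w by apply/eqP => vw; have := sw; rewrite -vw sv.
have := congr1 (fun f : labeling n K => f u) hp.
have := congr1 (fun f : labeling n K => f w) hp.
rewrite !ffunE tpermL tpermD// sw su sv => <- /(congr1 val); done.
Qed.

(** * The two-point lower bound *)

Lemma two_labelings_bound (R : realType) (n K : nat) (a b rho : R)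
    (sigma : labeling n K -> labeling n K) (M : mechanism R n K) :
  (2 <= K)%N -> (K %| n)%N -> (2 <= n %/ K)%N ->
  0 <= a <= n%:R -> 0 <= b <= n%:R -> representatives sigma ->
  node_zCDP rho M ->
  exists2 theta, Sigma theta &
    4^-1 * expR (- (4 * rho)) <=
      sbm_Pr a b theta M (fun t => 0 < mismatch R (sigma theta) t).
Proof.
move=> hK hdvd hnK ha hb hsigma hM.
have [s hs] := Sigma_nonempty (ltnW hK) hdvd.
have [u [v huv]] := Sigma_swap_pair hK hnK hs.
have n0 : (0 < n)%N by exact: leq_ltn_trans (ltn_ord u).
set s' := label_perm (tperm u v) s in huv.
have hs' : Sigma s' by exact: Sigma_label_perm.
pose E (x t : labeling n K) := 0 < mismatch R (sigma x) t.
(* An output recovering [s] fails for [s']: otherwise passing from [s] to [t] and back to [s'],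
   through both representatives, would make [s'] a relabeling of [s]. *)
have hE t : predC (E s) t -> E s' t.
  move=> /(mismatch_le0 n0)[q hq]; apply: contraPT isT => /(mismatch_le0 n0)[q' hq'].
  have [_ [p hp]] := hsigma _ hs; have [_ [p' hp']] := hsigma _ hs'.
  case: (huv (p * q * q'^-1 * p'^-1)%g); apply/ffunP => i.
  have := congr1 (fun f : labeling n K => f i) (etrans hq (esym hq')).
  by rewrite hp hp' !ffunE !permM => ->; rewrite !permK.
have := le_trans (sbm_swap_testing s u v (E s) ha hb hM)
  (lerD (lexx _) (sbm_Pr_mono s' M ha hb hE)) => h.
have [h1|h1] := lerP (4^-1 * expR (- (4 * rho))) (sbm_Pr a b s M (E s)).
  by exists s.
by exists s' => //; rewrite -/(E s'); lra.
Qed.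

Theorem theorem6 (R : realType) (n K : nat) (a b rho : R)
    (sigma : labeling n K -> labeling n K)
    (hK : (2 <= K)%N) (hdvd : (K %| n)%N) (hnK : (2 <= n %/ K)%N)
    (ha : 0 <= a <= n%:R) (hb : 0 <= b <= n%:R)
    (hsigma : representatives sigma) :
  ((4^-1 * expR (- (4 * rho)))%:E <=
     ereal_inf [set ereal_sup
       [set (sbm_Pr a b theta M (fun t => (0 : R) < mismatch R (sigma theta) t))%:E
         | theta in @Sigma n K]
       | M in @node_zCDP R n K rho])%E
  /\
  (((4 * n%:R)^-1 * expR (- (4 * rho)))%:E <=
     ereal_inf [set ereal_sup
       [set (sbm_Ex a b theta M (fun t => mismatch R (sigma theta) t))%:E
         | theta in @Sigma n K]
       | M in @node_zCDP R n K rho])%E.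
Proof.
split; apply: le_ereal_inf_tmp => _ [M hM <-];
  have [theta hth hle] := two_labelings_bound hK hdvd hnK ha hb hsigma hM.
  apply: (@le_trans _ _ (sbm_Pr a b theta M
    (fun t => 0 < mismatch R (sigma theta) t))%:E); first by rewrite lee_fin.
  by apply: ereal_sup_ubound; exists theta.
apply: (@le_trans _ _ (sbm_Ex a b theta M
  (fun t => mismatch R (sigma theta) t))%:E); last first.
  by apply: ereal_sup_ubound; exists theta.
rewrite lee_fin; apply: le_trans (sbm_Ex_mismatch_ge _ _ _ ha hb).
by rewrite invfM mulrAC ler_wpM2r// invr_ge0 ler0n.
Qed.
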